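(* Let $G$ be a finite simple cubic (3-regular) graph, and let $\mathrm{oct}(G)$ denote the odd cycle transversal number of $G$, i.e. the minimum size of a set $S\subseteq V(G)$ such that the induced subgraph $G[V(G)\setminus S]$ is bipartite. Then $$\ell(\mathcal A(G))=2\,\mathrm{oct}(G).$$
   Context: Fix an orientation of the edges of $G=(V,E)$; the oriented incidence matrix $D$ is the $|V|\times|E|$ matrix with $D_{ve}=+1$ if $v$ is the head of $e$, $-1$ if $v$ is the tail of $e$, and $0$ otherwise. The antisymmetric line graph $\mathcal A(G)$ is the signed graph with vertex set $E(G)$ and signed adjacency matrix $D^{\mathsf T}D-2I$ (nonzero entries are edges, with the entry $\pm1$ as sign). Switching a signed graph at a vertex reverses the signs of all edges incident to it; changing the orientation changes $\mathcal A(G)$ only by switching. The sign of a cycle is the product of its edge signs, and a signed graph is balanced if all its cycles are positive. The frustration index $\ell(\Sigma)$ of a signed graph $\Sigma$ is the minimum number of edges whose deletion makes $\Sigma$ balanced (equivalently, the minimum number of negative edges among all switchings of $\Sigma$); it is switching invariant. *)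

(* Defs.v *)
From HB Require Import structures.
From mathcomp Require Import all_boot all_algebra.

Set Implicit Arguments.
Unset Strict Implicit.
Unset Printing Implicit Defensive.

Import GRing.Theory.
Local Open Scope ring_scope.

Record sgraph := SGraph {
  vertex :> finType;
  adj : rel vertex;
  adj_sym : symmetric adj;
  adj_irrefl : irreflexive adj }.

Definition cubic (G : sgraph) : Prop :=
  forall v : G, #|[set w | adj v w]| = 3%N.

Definition bipartite (G : sgraph) : bool :=
  [exists A : {set G},
    [forall x, forall y, adj x y ==> ((x \in A) != (y \in A))]].

Section Induced.
Variables (G : sgraph) (A : {set G}).

Definition induced_adj : rel {x : G | x \in A} :=
  fun x y => adj (val x) (val y).

Lemma induced_sym : symmetric induced_adj.
Proof. by move=> x y; apply: adj_sym. Qed.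

Lemma induced_irrefl : irreflexive induced_adj.
Proof. by move=> x; apply: adj_irrefl. Qed.

Definition induced : sgraph := SGraph induced_sym induced_irrefl.
End Induced.

Definition odd_cycle_transversal (G : sgraph) (S : {set G}) : bool :=
  bipartite (induced (~: S)).

Definition oct (G : sgraph) : nat :=
  #|[arg min_(S < [set: G] | odd_cycle_transversal S) #|S| ]|.

(* The default value setT of the argmin is admissible, so oct G is a genuine
   minimum. *)
Lemma octP (G : sgraph) :
  (exists2 S : {set G}, odd_cycle_transversal S & #|S| = oct G) /\
  (forall S : {set G}, odd_cycle_transversal S -> (oct G <= #|S|)%N).
Proof.
rewrite /oct; case: arg_minnP => [|S oS minS].
  apply/existsP; exists set0; apply/forallP => -[x xT].
  by suff: x \in set0; [rewrite inE | rewrite -setCT].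
by split; [exists S | exact: minS].
Qed.

Definition edge_pred (G : sgraph) : pred {set G} :=
  fun s => [exists x, exists y, adj x y && (s == [set x; y])].

Definition edge (G : sgraph) : finType := {s : {set G} | edge_pred s}.

Record orientation (G : sgraph) := Orientation {
  head : edge G -> G;
  tail : edge G -> G;
  edge_ends : forall e, val e = [set tail e; head e] }.

Lemma card_edge (G : sgraph) (e : edge G) : #|val e| = 2%N.
Proof.
case: e => s /= /existsP[x /existsP[y /andP[xy /eqP->]]].
rewrite cards2; case: eqP => [Exy|//].
by rewrite Exy adj_irrefl in xy.
Qed.

Lemma orientation_exists (G : sgraph) : inhabited (orientation G).
Proof.
have /fin_all_exists [h hP] (e : edge G) :
    exists p : G * G, val e = [set p.1; p.2].
  case: e => s /= /existsP[x /existsP[y /andP[_ /eqP->]]].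
  by exists (x, y).
by split; exact: (Orientation hP).
Qed.

(* Rows and columns are numbered by enum_rank. *)
Definition incidence_mx (G : sgraph) (o : orientation G) :
    'M[int]_(#|G|, #|edge G|) :=
  \matrix_(i, j) let v := enum_val i in let e := enum_val j in
    if v == head o e then 1 else if v == tail o e then -1 else 0.

(* A signed simple graph, presented by the entries of its signed adjacency
   matrix: sadj x y is the sign of the edge xy, and 0 if xy is not an edge. *)
Record signed_graph := SignedGraph {
  svertex :> finType;
  sadj : svertex -> svertex -> int;
  sadj_sym : forall x y, sadj x y = sadj y x;
  sadj_irrefl : forall x, sadj x x = 0;
  sadj_sign : forall x y, sadj x y \in [:: -1; 0; 1] }.

Definition sedges (Sg : signed_graph) : {set {set Sg}} :=
  [set [set p.1; p.2] | p : Sg * Sg & sadj p.1 p.2 != 0].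

Section DeleteEdges.
Variables (Sg : signed_graph) (F : {set {set Sg}}).

Definition delete_sadj (x y : Sg) : int :=
  if [set x; y] \in F then 0 else sadj x y.

Lemma delete_sym x y : delete_sadj x y = delete_sadj y x.
Proof. by rewrite /delete_sadj setUC sadj_sym. Qed.

Lemma delete_irrefl x : delete_sadj x x = 0.
Proof. by rewrite /delete_sadj sadj_irrefl if_same. Qed.

Lemma delete_sign x y : delete_sadj x y \in [:: -1; 0; 1].
Proof. by rewrite /delete_sadj; case: ifP => // _; apply: sadj_sign. Qed.

Definition delete_edges : signed_graph :=
  SignedGraph delete_sym delete_irrefl delete_sign.
End DeleteEdges.

Definition is_cycle (Sg : signed_graph) (c : seq Sg) : bool :=
  [&& (2 < size c)%N, uniq c & cycle (fun x y => sadj x y != 0) c].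

Definition cycle_sign (Sg : signed_graph) (c : seq Sg) : int :=
  \prod_(x <- c) sadj x (next c x).

(* Cycles have no repeated vertex, so bounding their length by the order of the
   graph loses nothing, and makes balance decidable: see balancedP. *)
Definition balanced (Sg : signed_graph) : bool :=
  [forall n : 'I_#|Sg|.+1, forall c : n.-tuple Sg,
    is_cycle c ==> (cycle_sign c == 1)].

Lemma balancedP (Sg : signed_graph) :
  reflect (forall c : seq Sg, is_cycle c -> cycle_sign c = 1) (balanced Sg).
Proof.
apply: (iffP forallP) => [bal c cc | bal n].
  have sc : (size c < #|Sg|.+1)%N.
    by case/and3P: cc => _ /card_uniqP <- _; rewrite ltnS max_card.
  have /forallP/(_ (in_tuple c)) := bal (Ordinal sc).
  by rewrite /= cc => /eqP.
by apply/forallP => c; apply/implyP => /bal->.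
Qed.

Definition frustration_index (Sg : signed_graph) : nat :=
  #|[arg min_(F < sedges Sg | (F \subset sedges Sg) &&
                              balanced (delete_edges F)) #|F| ]|.

(* The default value of the argmin is admissible, so frustration_index Sg is a
   genuine minimum. *)
Lemma frustration_indexP (Sg : signed_graph) :
  (exists2 F : {set {set Sg}},
     (F \subset sedges Sg) && balanced (delete_edges F) &
     #|F| = frustration_index Sg) /\
  (forall F : {set {set Sg}},
     (F \subset sedges Sg) && balanced (delete_edges F) ->
     (frustration_index Sg <= #|F|)%N).
Proof.
rewrite /frustration_index; case: arg_minnP => [|F oF minF].
  rewrite subxx; apply/balancedP => -[|x [|y c]] // /and3P[_ _ /=].
  rewrite {1}/delete_sadj; case: ifP; first by rewrite eqxx.
  move=> /negP nxy /andP[xy _]; case: nxy.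
  by apply/imsetP; exists (x, y); rewrite ?inE.
by split; [exists F | exact: minF].
Qed.

Section AntisymmetricLineGraph.
Variables (G : sgraph) (o : orientation G).

Definition alg_mx : 'M[int]_#|edge G| :=
  (incidence_mx o)^T *m incidence_mx o - 2%:M.

Definition alg_sadj (e f : edge G) : int :=
  alg_mx (enum_rank e) (enum_rank f).

Let d (v : G) (e : edge G) : int :=
  if v == head o e then 1 else if v == tail o e then -1 else 0.

Let head_tail e : head o e != tail o e.
Proof.
by move: (card_edge e); rewrite (edge_ends o e) cards2 eq_sym; case: eqP.
Qed.

Let alg_sadjE e f :
  alg_sadj e f = d (head o e) f - d (tail o e) f - (e == f)%:R *+ 2.
Proof.
rewrite /alg_sadj /alg_mx !mxE (inj_eq enum_rank_inj) -mulrnA mulnC mulrnA.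
congr (_ - _).
rewrite (reindex (@enum_rank G)) /=; last first.
  by exists enum_val => x _; rewrite ?enum_rankK ?enum_valK.
rewrite (eq_bigr (fun v => d v e * d v f)); last first.
  by move=> v _; rewrite !mxE !enum_rankK.
rewrite (bigD1 (head o e)) //= (bigD1 (tail o e)) /=; last first.
  by rewrite eq_sym head_tail.
rewrite big1 => [|v /andP[/negPf vh /negPf vt]]; last first.
  by rewrite {1}/d vh vt mul0r.
rewrite {1}/d eqxx mul1r {2}/d eqxx eq_sym (negPf (head_tail e)).
by rewrite mulN1r addr0.
Qed.

Lemma alg_sym e f : alg_sadj e f = alg_sadj f e.
Proof.
have trA : alg_mx^T = alg_mx.
  by rewrite /alg_mx linearB /= trmx_mul trmxK tr_scalar_mx.
by rewrite /alg_sadj -{1}trA mxE.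
Qed.

Lemma alg_irrefl e : alg_sadj e e = 0.
Proof.
by rewrite alg_sadjE /d !eqxx eq_sym (negPf (head_tail e)).
Qed.

Lemma alg_sign e f : alg_sadj e f \in [:: -1; 0; 1].
Proof.
have [->|nef] := eqVneq e f; first by rewrite alg_irrefl.
rewrite alg_sadjE (negPf nef) mul0rn subr0.
have dP v : v \notin val f -> d v f = 0.
  by rewrite (edge_ends o f) !inE negb_or /d => /andP[/negPf-> /negPf->].
have dS v : d v f \in [:: -1; 0; 1].
  by rewrite /d; case: ifP => // _; case: ifP.
have [hf|/dP->] := boolP (head o e \in val f); last first.
  by rewrite sub0r; have := dS (tail o e); rewrite !inE => /or3P[] /eqP->.
have [tf|/dP->] := boolP (tail o e \in val f); last by rewrite subr0.
case/eqP: nef; apply/val_inj/eqP.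
rewrite eqEcard !card_edge leqnn andbT (edge_ends o e).
by apply/subsetP => v; rewrite !inE => /orP[] /eqP->.
Qed.

Definition antisymmetric_line_graph : signed_graph :=
  SignedGraph alg_sym alg_irrefl alg_sign.
End AntisymmetricLineGraph.

(* Main.v *)
Require Import Defs.
From mathcomp Require Import all_boot.
From mathcomp Require Import all_algebra.

(** By Harary's balance theorem the frustration index is the least number of
    negative edges over all switchings, and switching the antisymmetric line
    graph amounts to reorienting [G]. Two edges of [G] meeting at [v] are joined
    by a negative edge iff exactly one of them points to [v]; hence a cubic
    vertex contributes no negative edge if it is a source or a sink, and two
    otherwise. Finally, a vertex set can be made to consist of sources and sinks
    iff it induces a bipartite graph. *)

Set Implicit Arguments.
Unset Strict Implicit.
Unset Printing Implicit Defensive.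

Import GRing.Theory.
Local Open Scope ring_scope.

(** * Signs of walks and Harary's balance theorem *)

Section Walks.
Variable Sg : signed_graph.
Implicit Types (x y z : Sg) (p q : seq Sg) (t : Sg -> bool).

Definition sadjacent : rel Sg := fun x y => sadj x y != 0.

Fixpoint walk_sign x p : int :=
  if p is y :: q then sadj x y * walk_sign y q else 1.

Lemma walk_sign_cat x p q :
  walk_sign x (p ++ q) = walk_sign x p * walk_sign (last x p) q.
Proof. by elim: p x => [|y p IH] x /=; rewrite ?mul1r // IH mulrA. Qed.

Lemma sadj_sqr x y : sadjacent x y -> sadj x y * sadj x y = 1.
Proof.
by rewrite /sadjacent; have := sadj_sign x y; rewrite !inE => /or3P[]/eqP->.
Qed.

Lemma walk_sign_sqr x p : path sadjacent x p -> walk_sign x p * walk_sign x p = 1.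
Proof.
elim: p x => [|y p IH] x //= /andP[xy yp].
by rewrite mulrACA sadj_sqr // IH // mulr1.
Qed.

(** Keeping the closing vertex [y] apart from the first vertex [x] lets the induction on [p] go
    through. *)
Lemma walk_sign_next_at x y p : uniq (x :: p) ->
  \prod_(z <- x :: p) sadj z (next_at z y x p) = walk_sign x (rcons p y).
Proof.
elim: p x => [|x' p IH] x; first by rewrite big_seq1 /= eqxx mulr1.
rewrite big_cons => /andP[xp up]; rewrite /= eqxx -IH //; congr (_ * _).
apply: eq_big_seq => z zp /=; case: eqP => // zx.
by rewrite -zx zp in xp.
Qed.

Lemma cycle_sign_walk x p : uniq (x :: p) ->
  cycle_sign (x :: p) = walk_sign x (rcons p x).
Proof. exact: walk_sign_next_at. Qed.

(** Strong induction on the length: a walk that repeats a vertex splits there into two shorter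
    closed walks; one that does not is empty, runs back and forth along one edge, or is a cycle. *)
Lemma closed_walk_sign x p : balanced Sg ->
  path sadjacent x p -> last x p = x -> walk_sign x p = 1.
Proof.
move=> /balancedP bal.
have [n] := ubnP (size p); elim: n => // n IH in x p *.
(* A nonempty [p] ends with the start [x], so [uniq p] says that the closed walk repeats no
   vertex. *)
rewrite ltnS => sp xp lp; have [up|] := boolP (uniq p).
  case/lastP: p => [|p z] // in xp lp up sp *.
  rewrite last_rcons in lp; subst z; rewrite rcons_uniq in up.
  rewrite -cycle_sign_walk //; case: p => [|y [|z p]] in up xp sp *.
  - by move: xp; rewrite /= /sadjacent sadj_irrefl eqxx.
  - rewrite cycle_sign_walk //= mulr1 (sadj_sym y) sadj_sqr //.
    by case/andP: xp.
  - by apply: bal; apply/and3P; split.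
case/(uniqPn x) => i [j [ltij ltj Eij]].
set y := nth x p i in Eij.
(* Cut after both occurrences of [y]: the middle piece is closed at [y], and removing it leaves a
   closed walk at [x]. *)
have Ep : p = rcons (take i p) y ++ rcons (take (j - i.+1) (drop i.+1 p)) y
              ++ drop j.+1 p.
  rewrite -take_nth ?(ltn_trans ltij) // Eij.
  have -> : nth x p j = nth x (drop i.+1 p) (j - i.+1) by rewrite nth_drop subnKC.
  rewrite -take_nth ?size_drop ?ltn_sub2r ?(leq_ltn_trans ltij) //.
  rewrite -{1}(cat_take_drop i.+1 p) -{1}(cat_take_drop (j - i.+1).+1 (drop _ _)).
  by rewrite drop_drop addSn subnK.
move: (take i p) (take (j - i.+1) _) (drop j.+1 p) Ep => p1 p2 p3 Ep.
move: xp lp sp; rewrite Ep !cat_path !last_cat !last_rcons !size_cat !size_rcons.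
case/and3P=> xp1 yp2 yp3 lp3 sp.
rewrite !walk_sign_cat !last_rcons (IH y (rcons p2 y)) ?last_rcons ?size_rcons //.
  rewrite mul1r -[in walk_sign y p3](last_rcons x p1 y) -walk_sign_cat.
  apply: IH; rewrite ?cat_path ?last_cat ?last_rcons ?xp1 //.
  rewrite size_cat size_rcons; apply: leq_trans sp; rewrite ltn_add2l.
  by rewrite addSn ltnS leq_addl.
by apply: leq_trans sp; rewrite addSn ltnS addnCA leq_addr.
Qed.

Lemma walk_sign_switch t x p :
  (forall y z, sadjacent y z -> sadj y z = (-1) ^+ (t y (+) t z)) ->
  path sadjacent x p -> walk_sign x p = (-1) ^+ (t x (+) t (last x p)).
Proof.
move=> tP; elim: p x => [|y p IH] x /=; first by rewrite addbb.
by case/andP=> xy yp; rewrite tP // IH // -signr_addb addbA addbK.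
Qed.

(** The signs of chosen walks from the root of each component provide [t]. Conversely, along a cycle
    the values of [t] cancel. *)
Lemma harary_balance :
  balanced Sg <->
  exists t, forall x y, sadjacent x y -> sadj x y = (-1) ^+ (t x (+) t y).
Proof.
split=> [bal | [t tP]]; last first.
  apply/balancedP => -[|x p] // /and3P[_ up cp].
  by rewrite cycle_sign_walk // (walk_sign_switch tP cp) last_rcons addbb.
have sym : connect_sym sadjacent.
  by apply: sym_connect_sym => x y; rewrite /sadjacent sadj_sym.
have /fin_all_exists[w wP] x :
    exists p, path sadjacent (fingraph.root sadjacent x) p /\
              last (fingraph.root sadjacent x) p = x.
  have /connectP[p xp lp] : connect sadjacent (fingraph.root sadjacent x) x.
    by rewrite sym connect_root.
  by exists p.
pose g x := walk_sign (fingraph.root sadjacent x) (w x).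
have gP x : g x * g x = 1 by case: (wP x) => ? _; apply: walk_sign_sqr.
have gE x : g x = (-1) ^+ (g x != 1).
  have /eqP := gP x; rewrite -expr2 sqrf_eq1 => /orP[]/eqP-> //=.
exists (fun x => g x != 1) => x y xy; rewrite signr_addb -!gE.
case: (wP x) (wP y) => px lx [py ly].
have rxy : fingraph.root sadjacent x = fingraph.root sadjacent y.
  by apply/eqP; rewrite root_connect // connect1.
(* The walk [q] back to the root closes both the chosen walk to [y] and the chosen walk to [x]
   extended by the edge [xy]; comparing the two signs gives that of [xy]. *)
have /connectP[q yq lq] := connect_root sadjacent y.
have Gx : g x * (sadj x y * walk_sign y q) = 1.
  rewrite -[sadj x y * _]/(walk_sign x (y :: q)) -{2}lx -walk_sign_cat.
  apply: closed_walk_sign => //; rewrite ?cat_path ?last_cat lx /= ?px ?xy //.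
  by rewrite -lq rxy.
have Gy : g y * walk_sign y q = 1.
  rewrite -{2}ly -walk_sign_cat.
  by apply: closed_walk_sign => //; rewrite ?cat_path ?last_cat ly ?py.
have Eq : walk_sign y q = g y by rewrite -[LHS]mul1r -(gP y) -mulrA Gy mulr1.
by rewrite -[RHS]mulr1 -Gx Eq mulrACA gP mul1r mulrCA gP mulr1.
Qed.

End Walks.

(** * Frustration index and switchings *)

(** These are the edges that become negative after switching at the vertices where [t] holds. *)
Definition negative_edges (Sg : signed_graph) (t : Sg -> bool) : {set {set Sg}} :=
  [set [set p.1; p.2] | p : Sg * Sg & (sadj p.1 p.2 != 0) &&
                                (sadj p.1 p.2 != (-1) ^+ (t p.1 (+) t p.2))].

(** Once these edges are deleted, [t] itself witnesses balance. *)
Lemma frustration_index_le (Sg : signed_graph) (t : Sg -> bool) :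
  (frustration_index Sg <= #|negative_edges t|)%N.
Proof.
apply: (frustration_indexP Sg).2; apply/andP; split.
  apply/subsetP => _ /imsetP[p + ->]; rewrite inE => /andP[p0 _].
  by apply/imsetP; exists p; rewrite ?inE.
apply/harary_balance; exists t => x y.
rewrite /sadjacent /= /delete_sadj; case: ifP => [|nF xy]; first by rewrite eqxx.
apply/eqP; apply: contraFT nF => xyt.
by apply/imsetP; exists (x, y); rewrite ?inE ?xy.
Qed.

(** Balance after deleting a minimum set [F] yields a [t] making every edge outside [F] positive, so
    the negative edges lie in [F]. *)
Lemma frustration_index_ge (Sg : signed_graph) :
  exists t : Sg -> bool, (#|negative_edges t| <= frustration_index Sg)%N.
Proof.
have [F /andP[_ /harary_balance[t tP]] <-] := (frustration_indexP Sg).1.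
exists t; apply/subset_leq_card/subsetP => _ /imsetP[[x y] + ->].
rewrite inE /= => /andP[xy]; apply: contraNT => nF.
have := tP x y; rewrite /sadjacent /= /delete_sadj (negPf nF) => -> //.
Qed.

(** * Signs in the antisymmetric line graph *)

Section LineGraph.
Variables (G : sgraph) (o : orientation G).
Implicit Types (v x y : G) (e f : edge G) (t : edge G -> bool).

Lemma head_in e : Defs.head o e \in val e.
Proof. by rewrite (edge_ends o) !inE eqxx orbT. Qed.

Lemma tail_in e : tail o e \in val e.
Proof. by rewrite (edge_ends o) !inE eqxx. Qed.

Lemma head_neq_tail e : Defs.head o e != tail o e.
Proof. by move: (card_edge e); rewrite (edge_ends o e) cards2 eq_sym; case: eqP. Qed.

Lemma edge_ends_neq e x y :
  x \in val e -> y \in val e -> x != y -> (x == Defs.head o e) = (y != Defs.head o e).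
Proof.
rewrite (edge_ends o) !inE => /orP[]/eqP-> /orP[]/eqP->; rewrite ?eqxx //.
  by move=> /negPf->.
by rewrite eq_sym => ->.
Qed.

Lemma adj_ends e x y : x \in val e -> y \in val e -> x != y -> adj x y.
Proof.
case: e => s /= /existsP[a /existsP[b /andP[ab /eqP->]]].
rewrite !inE => /orP[]/eqP-> /orP[]/eqP->; rewrite ?eqxx // => _.
by rewrite adj_sym.
Qed.

Lemma adj_edge x y : adj x y -> exists e : edge G, val e = [set x; y].
Proof.
move=> xy; have He : edge_pred [set x; y].
  by apply/existsP; exists x; apply/existsP; exists y; rewrite xy eqxx.
by exists (Sub [set x; y] He : edge G).
Qed.

Lemma edge_common e f x y : e != f ->
  x \in val e -> x \in val f -> y \in val e -> y \in val f -> x = y.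
Proof.
move=> nef xe xf ye yf; apply/eqP; apply: contraNT nef => nxy.
have E (g : edge G) : x \in val g -> y \in val g -> val g = [set x; y].
  move=> xg yg; apply/eqP; rewrite eq_sym eqEcard card_edge cards2 nxy andbT.
  by apply/subsetP => z; rewrite !inE => /orP[]/eqP->.
by apply/eqP/val_inj; rewrite (E e xe ye) (E f xf yf).
Qed.

(** Only common ends contribute to the product of two incidence columns, and the subtracted diagonal
    vanishes at [e != f]. *)
Lemma alg_sadjE e f : e != f ->
  alg_sadj o e f = \sum_(v in val e :&: val f)
     (-1) ^+ ((v == Defs.head o e) (+) (v == Defs.head o f)).
Proof.
have entryE g v : incidence_mx o (enum_rank v) (enum_rank g) =
    (-1) ^+ (v != Defs.head o g) *+ (v \in val g).
  rewrite mxE !enum_rankK (edge_ends o) !inE /=.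
  by case: (eqVneq v (Defs.head o g)); case: (eqVneq v (tail o g)).
move=> nef; rewrite /alg_sadj /alg_mx mxE [X in _ + X]mxE [X in _ - X]mxE.
rewrite (inj_eq enum_rank_inj) (negPf nef) subr0 mxE.
rewrite (reindex (@enum_rank G)) /=; last first.
  by exists enum_val => x _; rewrite ?enum_rankK ?enum_valK.
rewrite [RHS]big_mkcond; apply: eq_bigr => v _; rewrite mxE !entryE inE.
rewrite mulrnAl mulrnAr -mulrnA mulnb andbC -signr_addb addbN addNb negbK.
by case: (_ && _).
Qed.

Lemma alg_sadj_common v e f : e != f -> v \in val e -> v \in val f ->
  alg_sadj o e f = (-1) ^+ ((v == Defs.head o e) (+) (v == Defs.head o f)).
Proof.
move=> nef ve vf; rewrite alg_sadjE // (big_pred1 v) // => x.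
rewrite !inE; apply/andP/eqP => [[xe xf]|-> //].
exact: edge_common nef xe xf ve vf.
Qed.

Lemma alg_sadj_neq0 e f : alg_sadj o e f != 0 ->
  e != f /\ exists2 v, v \in val e & v \in val f.
Proof.
have [->|nef] := eqVneq e f; first by rewrite alg_irrefl eqxx.
rewrite alg_sadjE // => s0; split=> //.
have [E0|[v]] := set_0Vmem (val e :&: val f).
  by rewrite E0 big_set0 eqxx in s0.
by rewrite inE => /andP[]; exists v.
Qed.

(** * Counting negative edges vertex by vertex *)

Definition star v : {set edge G} := [set e : edge G | v \in val e].

Lemma card_star v : #|star v| = #|[set w | adj v w]|.
Proof.
rewrite -(card_imset _ val_inj) -[RHS](@card_in_imset _ _ (fun w => [set v; w])).
  congr #|pred_of_set _|; apply/setP => s; apply/imsetP/imsetP => -[].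
    move=> e; rewrite inE => + ->.
    case: e => _ /= /existsP[x /existsP[y /andP[xy /eqP->]]].
    rewrite !inE => /orP[]/eqP->; first by exists y; rewrite ?inE.
    by exists x; rewrite ?inE 1?adj_sym // setUC.
  move=> w; rewrite inE => vw ->; have [e Ee] := adj_edge vw.
  by exists e; rewrite // !inE Ee !inE eqxx.
move=> x y; rewrite !inE => vx vy /setP/(_ x); rewrite !inE eqxx orbT.
by case: eqP => [xv|_ /esym/eqP //]; rewrite xv adj_irrefl in vx.
Qed.

(** Switching the line graph at [e] amounts to reversing [e] in [G]. *)
Definition into t v e : bool := (v == Defs.head o e) (+) t e.

Definition in_star t v : {set edge G} := [set e in star v | into t v e].
Definition out_star t v : {set edge G} := [set e in star v | ~~ into t v e].

Definition negative_at t v : {set {set edge G}} :=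
  [set [set e; f] | e in in_star t v, f in out_star t v].

(** The vertices that are neither sources nor sinks after reversing the edges where [t] holds. *)
Definition mixed t : {set G} := [set v | (in_star t v != set0) && (out_star t v != set0)].

Lemma card_in_out_star t v : (#|in_star t v| + #|out_star t v|)%N = #|star v|.
Proof.
rewrite -(cardsID [set e | into t v e] (star v)); congr (_ + _)%N.
all: by apply: eq_card => e; rewrite !inE // andbC.
Qed.

(** Since [in_star] and [out_star] are disjoint, an unordered pair determines which member comes
    from which. *)
Lemma card_negative_at t v : #|negative_at t v| = (#|in_star t v| * #|out_star t v|)%N.
Proof.
rewrite /negative_at curry_imset2X card_in_imset ?cardsX //.
move=> [e f] [e' f'] /=; rewrite !inE /=.
move=> /andP[/andP[_ ie] /andP[_ of_]] /andP[/andP[_ ie'] /andP[_ of']] /setP E.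
have := E e; have := E f; rewrite !inE !eqxx orbT /=.
case: (eqVneq f e') => [fe'|_ /esym/eqP->]; first by rewrite fe' ie' in of_.
case: (eqVneq e f') => [ef'|_]; first by rewrite -ef' ie in of'.
by rewrite orbF => /esym/eqP->.
Qed.

Lemma card_negative_at_cubic t v : cubic G ->
  #|negative_at t v| = (2 * (v \in mixed t))%N.
Proof.
move=> cG; have := card_in_out_star t v.
rewrite card_negative_at card_star cG inE -!card_gt0.
(* The two sizes sum to 3, so their product is 0 if one is zero, and 1 times 2 otherwise. *)
by case: #|_| #|_| => [|[|[|[|?]]]] [|[|[|[|?]]]].
Qed.

Lemma negative_edgesE t :
  negative_edges (Sg := antisymmetric_line_graph o) t = \bigcup_v negative_at t v.
Proof.
have sgn v e f : e != f -> v \in val e -> v \in val f ->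
    (alg_sadj o e f != (-1) ^+ (t e (+) t f)) = (into t v e != into t v f).
  move=> nef ve vf; rewrite (alg_sadj_common nef ve vf) /into.
  by case: (v == _); case: (v == _); case: (t e); case: (t f).
apply/setP => s; apply/imsetP/bigcupP => [[[e f]]|[v _ /imset2P[e f]]].
  rewrite inE /= => /andP[/alg_sadj_neq0[nef [v ve vf]]].
  rewrite (sgn v) // => io ->; exists v => //.
  have [ie|ie] := boolP (into t v e); last rewrite setUC.
    by apply: imset2_f; rewrite !inE ?ve ?vf ?ie //;
      move: io; rewrite ie; case: into.
  by apply: imset2_f; rewrite !inE ?ve ?vf ?ie //;
      move: io; rewrite (negPf ie); case: into.
rewrite !inE => /andP[ve ie] /andP[vf of_] ->; exists (e, f) => //.
have nef : e != f by apply: contraNneq of_ => <-.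
rewrite inE /= (sgn v) // ie (negPf of_) andbT.
by rewrite (alg_sadj_common nef ve vf) signr_eq0.
Qed.

(** A common member would consist of two distinct edges of [G] sharing both ends [u] and [v]. *)
Lemma negative_at_disjoint t u v : u != v -> [disjoint negative_at t u & negative_at t v].
Proof.
move=> nuv; apply/pred0P => s /=; apply: contraNF nuv => /andP[].
case/imset2P=> e f; rewrite !inE => /andP[ue ie] /andP[uf of_] ->.
case/imset2P=> e' f'; rewrite !inE => /andP[ve' _] /andP[vf' _] E.
have nef : e != f by apply: contraNneq of_ => <-.
have H g : g \in [set e; f] -> v \in val g.
  by rewrite E !inE => /orP[]/eqP->.
by apply/eqP/(edge_common nef) => //; apply: H; rewrite !inE eqxx ?orbT.
Qed.

Lemma card_negative_edges t : cubic G ->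
  #|negative_edges (Sg := antisymmetric_line_graph o) t| = (2 * #|mixed t|)%N.
Proof.
move=> cG; rewrite negative_edgesE -sum1_card.
rewrite partition_disjoint_bigcup; last exact: negative_at_disjoint.
rewrite (eq_bigr (fun v => 2 * (v \in mixed t))%N) => [|v _].
  by rewrite -big_distrr /= -big_mkcond /= sum1_card.
by rewrite sum1_card card_negative_at_cubic.
Qed.

(** * Mixed vertices and odd cycle transversals *)

(** Outside [mixed t], a vertex with an incoming edge is a sink; each edge points to exactly one of
    its ends, so these vertices form one side of a bipartition. *)
Lemma mixed_transversal t : odd_cycle_transversal (mixed t).
Proof.
apply/existsP; exists [set x | in_star t (val x) != set0].
apply/forallP => x; apply/forallP => y; apply/implyP => xy.
have [e Ee] := adj_edge xy.
have nxy : val x != val y.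
  by apply: contraTneq xy => E; rewrite /= /induced_adj E adj_irrefl.
have xe : val x \in val e by rewrite Ee !inE eqxx.
have ye : val y \in val e by rewrite Ee !inE eqxx orbT.
have intoE (z : induced (~: mixed t)) : val z \in val e ->
    (in_star t (val z) != set0) = into t (val z) e.
  move=> ze; have := valP z; rewrite /mixed !inE negb_and !negbK.
  have [ie|ie] := boolP (into t (val z) e).
    by move=> _; apply/set0Pn; exists e; rewrite !inE ze.
  case/orP=> [-> //|/eqP/setP/(_ e)].
  by rewrite !inE ze ie.
by rewrite !inE !intoE // /into (edge_ends_neq xe ye nxy) addNb; case: (_ (+) _).
Qed.

Lemma transversal_mixed (S : {set G}) :
  odd_cycle_transversal S -> exists t, mixed t \subset S.
Proof.
case/existsP=> A0 /forallP bip.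
pose A := val @: A0.
have AP x y : x \notin S -> y \notin S -> adj x y -> (x \in A) != (y \in A).
  rewrite -!(in_setC _ S) => xS yS xy.
  have /forallP/(_ (Sub y yS))/implyP/(_ xy) := bip (Sub x xS).
  by rewrite -!(mem_imset _ _ val_inj).
(* The aim is that vertices outside [S] become sinks in [A] and sources off [A]. The head decides if
   it is outside [S], otherwise the tail; when both are outside, [AP] makes the two demands
   agree. *)
pose t e := if Defs.head o e \notin S then Defs.head o e \notin A else tail o e \in A.
exists t; suff intoE v e : v \notin S -> v \in val e -> into t v e = (v \in A).
  apply/subsetP => v; apply: contraTT => vS; rewrite inE negb_and !negbK.
  have [vA|vA] := boolP (v \in A); apply/orP; [right|left].
    by apply/eqP/setP => e; rewrite !inE; apply/andP => -[ve]; rewrite intoE ?vA.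
  by apply/eqP/setP => e; rewrite !inE; apply/andP => -[ve]; rewrite intoE ?(negPf vA).
move=> vS; rewrite (edge_ends o) !inE /into /t => /orP[]/eqP Ev; subst v.
  rewrite eq_sym (negPf (head_neq_tail e)) /=; case: ifP => // hS.
  have := AP _ _ hS vS (adj_ends (head_in e) (tail_in e) (head_neq_tail e)).
  by case: (_ \in A); case: (_ \in A).
by rewrite eqxx vS addTb negbK.
Qed.

End LineGraph.

Local Close Scope ring_scope.

Theorem theorem9 (G : sgraph) (o : orientation G) (cubicG : cubic G) :
  frustration_index (antisymmetric_line_graph o) = 2 * oct G.
Proof.
apply/eqP; rewrite eqn_leq; apply/andP; split.
  have [S /(transversal_mixed o)[t tS] <-] := (octP G).1.
  apply: leq_trans (@frustration_index_le (antisymmetric_line_graph o) t) _.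
  by rewrite card_negative_edges // leq_pmul2l // subset_leq_card.
have [t] := frustration_index_ge (antisymmetric_line_graph o).
rewrite card_negative_edges //; apply: leq_trans.
by rewrite leq_pmul2l // (octP G).2 // mixed_transversal.
Qed.
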